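(* Let $\Omega\subset\mathbb{R}^n$ be a bounded Borel set and let $F\subset\overline{\Omega}$ be closed such that for every $x\in F$ and every $\delta>0$ $$\mathcal{L}^n(B(x,\delta)\cap\Omega)>0 .$$ Furthermore, let $\sigma$ be a (signed) Radon measure on $F$. Then there exists $\mu\in\mathrm{ba}(\Omega,\mathcal{B}(\Omega),\mathcal{L}^n)$ such that for every $\phi\in C_e(\Omega)$ $$\int_\Omega\phi\,d\mu=\int_F\phi\,d\sigma ,$$ and moreover $\operatorname{core}\mu\subset F$ and $|\mu|(\Omega)=|\sigma|(F)$.
   Context: $\mathcal{B}(\Omega)$ is the Borel $\sigma$-algebra of $\Omega$, $\mathcal{L}^n$ is Lebesgue measure and $B(x,\delta)$ is the open ball. A measure is a finitely additive real-valued set function. $\mathrm{ba}(\Omega,\mathcal{B}(\Omega),\mathcal{L}^n)$ is the set of bounded measures $\mu$ on $\mathcal{B}(\Omega)$ such that $\mathcal{L}^n(B)=0$ implies $\mu(B)=0$ for all $B\in\mathcal{B}(\Omega)$; $|\mu|$ is the total variation. The core of $\mu$ is $\operatorname{core}\mu:=\{x\in\mathbb{R}^n:|\mu|(V\cap\Omega)>0\text{ for all open }V\subset\mathbb{R}^n\text{ with }x\in V\}$. $C_e(\Omega)$ is the space of continuous functions on $\Omega$ which extend to continuous functions on $\overline{\Omega}$ (equivalently, restrictions to $\Omega$ of continuous functions on $\overline{\Omega}$). The integral over $F\subset\overline\Omega$ is that of the continuous extension to $\overline{\Omega}$. For bounded measurable $f$, $\int_\Omega f\,d\mu:=\lim_k\int_\Omega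 s_k\,d\mu$, where $s_k$ are simple functions converging to $f$ in measure $|\mu|$ (i.e. $|\mu|^*\{|s_k-f|>\varepsilon\}\to0$ for all $\varepsilon>0$, with $|\mu|^*(B)=\inf\{|\mu|(A):A\in\mathcal B(\Omega),B\subset A\}$) and with $\int_\Omega|s_k-s_l|\,d|\mu|\to0$. Radon measures here are countably additive, real-valued (possibly signed) regular Borel measures. *)

(* Defs.v *)
From HB Require Import structures.
From mathcomp Require Import all_boot all_order all_algebra.
From mathcomp Require Import all_classical all_reals all_analysis.

Set Implicit Arguments.
Unset Strict Implicit.
Unset Printing Implicit Defensive.

Import Order.TTheory GRing.Theory Num.Theory.
Import numFieldNormedType.Exports.
Import HBSimple.

Local Open Scope classical_set_scope.
Local Open Scope ring_scope.

(* R^n is 'rV[R]_n; borelRn R n is R^n as a measurable space, with its Borel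
   sigma-algebra. The norm that the library puts on 'rV[R]_n is the sup norm;
   it is only used for topological notions and for boundedness. *)
Notation borelRn R n := (g_sigma_algebraType (@open 'rV[R]_n)).

Definition borel (R : realType) (n : nat) (A : set 'rV[R]_n) : Prop :=
  measurable (A : set (borelRn R n)).

Definition euclidean_ball (R : realType) (n : nat) (x : 'rV[R]_n) (delta : R) :
    set 'rV[R]_n :=
  [set y | Num.sqrt (\sum_(i < n) (y ord0 i - x ord0 i) ^+ 2) < delta].

Definition box (R : realType) (n : nat) (a b : 'rV[R]_n) : set 'rV[R]_n :=
  [set x | forall i, a ord0 i <= x ord0 i <= b ord0 i].

Definition box_volume (R : realType) (n : nat) (a b : 'rV[R]_n) : R :=
  \prod_(i < n) (b ord0 i - a ord0 i).

(* The infimum of the total volume of the coverings of A by countably many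
   nonempty, possibly degenerate, closed boxes. The index set D
   makes finite and empty coverings available, also when n = 0. *)
Definition lebesgue_Rn (R : realType) (n : nat) (A : set 'rV[R]_n) : \bar R :=
  ereal_inf [set v | exists (D : set nat) (a b : nat -> 'rV[R]_n),
    [/\ forall k i, a k ord0 i <= b k ord0 i,
        A `<=` \bigcup_(k in D) box (a k) (b k) &
        v = (\esum_(k in D) (box_volume (a k) (b k))%:E)%E]].

Definition tot_variation d (T : measurableType d) (R : realType)
    (mu : set T -> \bar R) (A : set T) : \bar R :=
  ereal_sup [set v | exists (k : nat) (B : 'I_k -> set T),
    [/\ forall i, measurable (B i), trivIset [set: 'I_k] B,
        \bigcup_i B i = A & v = (\sum_(i < k) `|mu (B i)|)%E]].

(* A measure on a Borel set A of R^n is represented by its extension by zero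
   to all Borel sets of R^n. *)
Definition carried_by d (T : measurableType d) (R : realType)
    (A : set T) (mu : set T -> \bar R) : Prop :=
  forall B, measurable B -> A `&` B = set0 -> mu B = 0%E.

(* {additive_charge set _ -> \bar R} is the library's type of real-valued
   finitely additive set functions. *)
Definition is_ba (R : realType) (n : nat) (Omega : set 'rV[R]_n)
    (mu : {additive_charge set (borelRn R n) -> \bar R}) : Prop :=
  [/\ carried_by (Omega : set (borelRn R n)) mu,
      exists M : R, forall B, borel B -> B `<=` Omega -> (`|mu B| <= M%:E)%E &
      forall B, borel B -> B `<=` Omega -> lebesgue_Rn B = 0%E -> mu B = 0%E].

Definition core (R : realType) (n : nat) (Omega : set 'rV[R]_n)
    (mu : set (borelRn R n) -> \bar R) : set 'rV[R]_n :=
  [set x | forall V : set 'rV[R]_n, open V -> V x ->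
    (0 < tot_variation mu (V `&` Omega))%E].

Section ba_integral.
Context d (T : measurableType d) (R : realType).
Variables (Omega : set T) (mu : set T -> \bar R).
Implicit Types (f : T -> R) (s : nat -> {sfun T >-> R}).

Definition outer_variation (B : set T) : \bar R :=
  ereal_inf [set tot_variation mu A | A in
    [set A | [/\ measurable A, A `<=` Omega & B `<=` A]]].

Definition cvg_in_measure s f : Prop :=
  forall eps : R, 0 < eps ->
    (fun k => outer_variation (Omega `&` [set x | eps < `|s k x - f x|]))
      @ \oo --> 0%E.

Definition determining s f : Prop :=
  cvg_in_measure s f /\
  forall eps : R, 0 < eps -> \forall k & l \near \oo,
    (sintegral (tot_variation mu)
       ((fun x => `|s k x - s l x|%R) \_ Omega) < eps%:E)%E.

(* "f is integrable over Omega with respect to mu, with integral I": some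
   sequence of simple functions determines f, and the integrals of any such
   sequence tend to I, so that I does not depend on the sequence. *)
Definition ba_integral_is f (I : \bar R) : Prop :=
  (exists s, determining s f) /\
  forall s, determining s f ->
    (fun k => sintegral mu (s k \_ Omega)) @ \oo --> I.

End ba_integral.

Definition hahn_sets d (T : measurableType d) (R : realType)
    (nu : {charge set T -> \bar R}) :
    {PN : set T * set T | hahn_decomposition nu PN.1 PN.2}.
Proof.
by apply: cid; have [P [N PN]] := Hahn_decomposition nu; exists (P, N).
Defined.

Definition charge_integral d (T : measurableType d) (R : realType)
    (nu : {charge set T -> \bar R}) (D : set T) (f : T -> R) : \bar R :=
  let PN := proj2_sig (hahn_sets nu) in
  (\int[jordan_pos PN]_(x in D) (f x)%:E
   - \int[jordan_neg PN]_(x in D) (f x)%:E)%E.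

(* A charge is real-valued and countably additive. *)
Definition radon_on (R : realType) (n : nat) (F : set 'rV[R]_n)
    (sigma : {charge set (borelRn R n) -> \bar R}) : Prop :=
  carried_by (F : set (borelRn R n)) sigma /\
  forall (A : set 'rV[R]_n) (eps : R), borel A -> 0 < eps ->
    exists K V : set 'rV[R]_n, [/\ compact K, open V, K `<=` A, A `<=` V &
      (tot_variation sigma (V `\` K) < eps%:E)%E].

(* phi belongs to C_e(Omega) and psi is its continuous extension to the
   closure of Omega; the values of phi outside Omega and of psi outside the
   closure are irrelevant. *)
Definition Ce_extension (R : realType) (n : nat) (Omega : set 'rV[R]_n)
    (phi psi : 'rV[R]_n -> R) : Prop :=
  [/\ {within Omega, continuous phi},
      {within closure Omega, continuous psi} &
      forall x, Omega x -> psi x = phi x].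

(* Main.v *)
Require Import Defs.
From HB Require Import structures.
From mathcomp Require Import all_boot all_order all_algebra.
From mathcomp Require Import all_classical all_reals all_analysis.
From mathcomp Require Import ring lra.

Set Implicit Arguments.
Unset Strict Implicit.
Unset Printing Implicit Defensive.

Import Order.TTheory GRing.Theory Num.Theory.
Import numFieldNormedType.Exports.

Local Open Scope classical_set_scope.
Local Open Scope ring_scope.

(** The measure is obtained by transporting sigma along ultrafilters. For each
  x in F the density hypothesis says that the sets B cap Omega, B a
  neighbourhood of x, are not Lebesgue null, so there is an ultrafilter U_x
  that contains Omega and the neighbourhoods of x but no null set. On the other
  hand sigma extends to a finitely additive nu on all subsets of R^n with the
  same variation bounds: take the limit, along an ultrafilter of finer and finer
  tagged partitions r, of sigma (r^-1 S). Then

    mu B := nu {x in F | B in U_x}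

  is finitely additive, since B |-> {x in F | B in U_x} is a Boolean
  homomorphism, and it does not charge null sets or sets at positive distance
  from F. As phi has limit psi x along U_x, the integral of phi against mu is
  that of psi against nu on F. The bound |mu|(Omega) <= |sigma|(F) is inherited
  from nu; for the converse, a positive Hahn set of sigma is approximated, by
  regularity, by an open set whose trace on Omega has nearly the same
  mu-measure. *)

(** * Lebesgue null sets and ultrafilters *)

Lemma lebesgue_Rn_le (R : realType) (n : nat) (A B : set 'rV[R]_n) :
  A `<=` B -> (lebesgue_Rn A <= lebesgue_Rn B)%E.
Proof.
move=> AB; apply: le_ereal_inf => v [D [a [b [ab cB vE]]]].
by exists D, a, b; split => //; exact: subset_trans AB cB.
Qed.

Lemma lebesgue_Rn_null_setU (R : realType) (n : nat) (A B : set 'rV[R]_n) :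
  (lebesgue_Rn A <= 0)%E -> (lebesgue_Rn B <= 0)%E ->
  (lebesgue_Rn (A `|` B) <= 0)%E.
Proof.
move=> A0 B0; apply/lee_addgt0Pr => e e0; rewrite add0e.
have e20 : (0 < (e / 2)%:E :> \bar R)%E by rewrite lte_fin divr_gt0.
have [_ [D1 [a1 [b1 [ab1 cA ->]]]] v1] := ereal_inf_lt (le_lt_trans A0 e20).
have [_ [D2 [a2 [b2 [ab2 cB ->]]]] v2] := ereal_inf_lt (le_lt_trans B0 e20).
(* The two coverings are interleaved, that of [A] at the even and that of [B] at the odd indices;
   each gets half of the tolerance [e]. *)
pose mix T (f g : nat -> T) k := if odd k then g k./2 else f k./2.
pose D : set nat := [set k | mix _ D1 D2 k].
have ab k i : mix _ a1 a2 k ord0 i <= mix _ b1 b2 k ord0 i.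
  by rewrite /mix; case: odd.
apply: le_trans (ereal_inf_lbound _) _.
  exists D, (mix _ a1 a2), (mix _ b1 b2); split => //.
  move=> x [/cA|/cB] [k Dk xk].
    by exists k.*2; rewrite /D /mix/= ?odd_double doubleK.
  by exists k.*2.+1; rewrite /D /mix/= odd_double/= uphalf_double.
set v := fun k => _.
have v_ge0 k : (0 <= v k)%E.
  by rewrite lee_fin prodr_ge0// => i _; rewrite subr_ge0.
rewrite (esumID [set k | odd k]); last by move=> k _; exact: v_ge0.
have -> : D `&` [set k | odd k] = (fun k => k.*2.+1) @` D2.
  apply/seteqP; split => [k [/=]|_ [k Dk <-]].
    rewrite /D /mix /= => + ok; rewrite ok => Dk; exists k./2 => //.
    by rewrite -[RHS](odd_double_half k) ok.
  by rewrite /D /mix /= odd_double/= uphalf_double.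
have -> : D `&` ~` [set k | odd k] = (fun k => k.*2) @` D1.
  apply/seteqP; split => [k [/=]|_ [k Dk <-]].
    rewrite /D /mix /= => + /negP/negbTE ok; rewrite ok => Dk; exists k./2 => //.
    by rewrite -[RHS](odd_double_half k) ok.
  by rewrite /D /mix /= odd_double/= doubleK.
rewrite !esum_image; last 2 first.
- by move=> x y _ _ /(congr1 half); rewrite !doubleK.
- by move=> x y _ _ /(congr1 half)/=; rewrite !uphalf_double.
rewrite [e]splitr EFinD leeD//; apply/ltW.
  apply: le_lt_trans v2; apply: le_esum => k _.
  by rewrite /v /mix/= odd_double/= uphalf_double.
apply: le_lt_trans v1; apply: le_esum => k _.
by rewrite /v /mix/= odd_double/= doubleK.
Qed.

(** The topology comes from the sup norm. The Euclidean norm dominates every coordinate, so the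
    Euclidean ball of the same radius is smaller. *)
Lemma nbhs_euclidean_ball (R : realType) (n : nat) (x : 'rV[R]_n)
    (V : set 'rV[R]_n) : nbhs x V ->
  exists2 e : R, 0 < e & euclidean_ball x e `<=` V.
Proof.
move=> /nbhs_ballP[e /= e0 eV]; exists e => // y xy; apply: eV.
split => // i j; rewrite (ord1 i) /ball/= distrC; apply: le_lt_trans xy.
rewrite -sqrtr_sqr ler_sqrt; last by apply: sumr_ge0 => k _; exact: sqr_ge0.
by rewrite (bigD1 j)//= lerDl sumr_ge0// => k _; exact: sqr_ge0.
Qed.

Lemma ultrafilter_at_density_point (R : realType) (n : nat)
    (Omega : set 'rV[R]_n) (x : 'rV[R]_n) :
  (forall delta : R, 0 < delta ->
     (0 < lebesgue_Rn (euclidean_ball x delta `&` Omega))%E) ->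
  exists U : set_system 'rV[R]_n, [/\ UltraFilter U, nbhs x `<=` U, U Omega &
    forall B, (lebesgue_Rn B <= 0)%E -> U (~` B)].
Proof.
move=> x_pos.
(* [G] consists of the sets that contain, up to a null set, the part of [Omega] in some
   neighbourhood of [x]. It is proper because that part is never null, and every ultrafilter above
   it has the required members. *)
pose G : set_system 'rV[R]_n := [set A | exists2 V, nbhs x V &
  (lebesgue_Rn ((V `&` Omega) `\` A) <= 0)%E].
have null0 : (lebesgue_Rn (set0 : set 'rV[R]_n) <= 0)%E.
  apply: ereal_inf_lbound; exists set0, (fun=> 0), (fun=> 0); split => //.
  by rewrite esum_set0.
have GF : ProperFilter G.
  split=> [[V /nbhs_euclidean_ball[e e0 eV]]|].
    rewrite setD0 => V0; have := x_pos _ e0; rewrite ltNge => /negP; apply.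
    by apply: le_trans V0; apply: lebesgue_Rn_le; exact: setSI.
  split.
  - by exists setT; [exact: filterT|rewrite setDT].
  - move=> A B [V xV VA] [W xW WB]; exists (V `&` W); first exact: filterI.
    apply: le_trans (lebesgue_Rn_null_setU VA WB); apply: lebesgue_Rn_le.
    move=> y [[[Vy Wy] Oy]]; rewrite /= not_andP => -[nA|nB]; [by left|by right].
  - move=> A B AB [V xV VA]; exists V => //; apply: le_trans VA.
    by apply: lebesgue_Rn_le; apply: setDS.
have [U [UU GU]] := ultraFilterLemma GF; exists U; split => //.
- move=> V xV; apply: GU; exists V => //.
  by rewrite (_ : _ `\` _ = set0)// -subset0 => y [[]].
- apply: GU; exists setT; first exact: filterT.
  by rewrite (_ : _ `\` _ = set0)// -subset0 => y [[]].
- move=> B B0; apply: GU; exists setT; first exact: filterT.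
  by apply: le_trans B0; apply: lebesgue_Rn_le => y [_]/=; rewrite notK.
Qed.

(** * Extension of a charge to all subsets *)

(** The image ultrafilter contains a compact segment, so it has a cluster point, and an ultrafilter
    converges to each of its cluster points. *)
Lemma ultrafilter_cvg (R : realType) (I : Type) (U : set_system I) (v : I -> R)
    (C : R) :
  UltraFilter U -> (\forall i \near U, `|v i| <= C) -> cvg (v @ U).
Proof.
move=> UU vC.
have : (v @ U) `[- C, C]%classic.
  by apply: filterS vC => i; rewrite ler_norml /= in_itv.
move=> /(@segment_compact R (- C) C)[l [_ cl_l]].
apply/cvg_ex; exists l => A Al.
have [//|UnA] := in_ultra_setVsetC (v @^-1` A) UU.
by have [y [nAy Ay]] := cl_l (~` A) A UnA Al.
Qed.

Section retraction_filter.
Context d (T : measurableType d).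

(* The maps r are thought of as tagged measurable partitions of T: the fibres
   of r are the cells, and r x is the tag of the cell of x. *)
Definition retraction_base (h : T -> nat) : set (T -> T) :=
  [set r | (forall S, measurable (r @^-1` S)) /\ h \o r = h].

(** Along this filter [r] is eventually finer than any given countable measurable partition [h]: the
    equation [h \o r = h] puts each tag in the same cell of [h] as the points it represents. *)
Definition retraction_filter : set_system (T -> T) :=
  filter_from [set h : T -> nat | forall S, measurable (h @^-1` S)]
    retraction_base.

Lemma retraction_base_nonempty (h : T -> nat) :
  (forall S, measurable (h @^-1` S)) -> retraction_base h !=set0.
Proof.
move=> mh.
have [t0|/forallNP noT] := pselect (exists t : T, True); last first.
  exists id; split => // S; rewrite (_ : _ @^-1` _ = set0) //.
  by rewrite -subset0 => x; have := noT x.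
have : exists f : nat -> T, forall x, h (f (h x)) = h x.
  have [t _] := t0.
  suff /choice[f fP] : forall k, exists y, forall x, h x = k -> h y = k.
    by exists f => x; exact: fP.
  move=> k; have [[y yk]|nk] := pselect (exists y, h y = k).
    by exists y.
  by exists t => x xk; exfalso; apply: nk; exists x.
move=> [f fh]; exists (f \o h); split => [S|]; first exact: (mh (f @^-1` S)).
by apply/funext => x /=.
Qed.

Lemma measurable_nat_preimage (h : T -> nat) :
  (forall k, measurable (h @^-1` [set k])) -> forall S, measurable (h @^-1` S).
Proof.
move=> mh S; rewrite (_ : _ @^-1` _ = \bigcup_(k in S) h @^-1` [set k]).
  by apply: bigcup_measurable => k _; exact: mh.
by apply/seteqP; split => [x Sx|x [k Sk] /= ->//]; exists (h x).
Qed.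

Lemma retraction_filter_proper : ProperFilter retraction_filter.
Proof.
apply: filter_from_proper; last by move=> h; exact: retraction_base_nonempty.
apply: filter_from_filter.
  by exists (fun=> 0%N) => S/=; rewrite preimage_cst; case: ifP.
(* The common refinement of two countable partitions: the pair of cell numbers is coded as one
   number. *)
move=> h1 h2 m1 m2; exists (fun x => pickle (h1 x, h2 x)).
  apply: measurable_nat_preimage => k.
  have [[[a b] <-]|nk] := pselect (exists p : nat * nat, pickle p = k).
    rewrite (_ : _ @^-1` _ = h1 @^-1` [set a] `&` h2 @^-1` [set b]).
      exact: measurableI.
    apply/seteqP; split => x /=; last by move=> [-> ->].
    by move=> /(pcan_inj pickleK)[].
  rewrite (_ : _ @^-1` _ = set0) // -subset0 => x /= xk; apply: nk.
  by exists (h1 x, h2 x).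
move=> r [mr rE]; split; split => //; apply/funext => x /=;
  by have /(pcan_inj pickleK)[] := congr1 (@^~ x) rE.
Qed.

Lemma retraction_filter_measurable :
  \forall r \near retraction_filter, forall S, measurable (r @^-1` S).
Proof.
exists (fun=> 0%N); first by move=> S/=; rewrite preimage_cst; case: ifP.
by move=> r [].
Qed.

(** Take for [h] the partition into [A] and its complement: tags stay in the cell of their points,
    so [r] moves no point into or out of [A]. This makes the limit charge agree with [sigma] on
    measurable sets. *)
Lemma retraction_filter_fix (A : set T) : measurable A ->
  \forall r \near retraction_filter, r @^-1` A = A.
Proof.
move=> mA; exists (fun x => nat_of_bool `[< A x >]).
  apply: measurable_nat_preimage => -[|[|k]].
  - rewrite (_ : _ @^-1` _ = ~` A); first exact: measurableC.
    by apply/seteqP; split => x /=; case: asboolP.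
  - rewrite (_ : _ @^-1` _ = A) //.
    by apply/seteqP; split => x /=; case: asboolP.
  - rewrite (_ : _ @^-1` _ = set0) // -subset0 => x /=; by case: asboolP.
move=> r [_ rE]; apply/seteqP; split => x /=;
  by have /= := congr1 (@^~ x) rE; do 2 case: asboolP.
Qed.

End retraction_filter.

Lemma tot_variation_ge (d : measure_display) (T : measurableType d)
    (R : realType) (mu : set T -> \bar R) (J : finType) (B : J -> set T) :
  (forall j, measurable (B j)) -> trivIset [set: J] B ->
  (\sum_(j : J) `|mu (B j)| <= tot_variation mu (\bigcup_j B j))%E.
Proof.
move=> mB tB; apply: ereal_sup_ubound.
exists #|J|, (fun i => B (enum_val i)); split => //.
- by move=> i j _ _ /(tB _ _ I I) /enum_val_inj.
- apply/seteqP; split => x [i _ Bx]; first by exists (enum_val i).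
  by exists (enum_rank i) => //; rewrite enum_rankK.
- by rewrite (reindex (@enum_val J predT)) //; exact/onW_bij/enum_val_bij.
Qed.

(** [G] will be the class of measurable sets or of all sets, and [V] the reals or the extended
    reals, so that one induction serves measures, finitely additive functions and [nu]. *)
Lemma additive_bigcup (T : Type) (V : nmodType) (G : set (set T))
    (m : set T -> V) :
  G set0 -> (forall A B, G A -> G B -> G (A `|` B)) -> m set0 = 0 ->
  (forall A B, G A -> G B -> A `&` B = set0 -> m (A `|` B) = m A + m B) ->
  forall (J : finType) (S : J -> set T), (forall j, G (S j)) ->
    trivIset setT S -> m (\bigcup_j S j) = \sum_j m (S j).
Proof.
move=> G0 GU m0 mU J S GS tS.
have -> : \bigcup_j S j = \bigcup_(j in [set` index_enum J]) S j.
  by congr bigcup; apply/seteqP; split => j //= _; rewrite mem_index_enum.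
rewrite bigcup_seq.
suff : forall s, uniq s -> G (\big[setU/set0]_(j <- s) S j) /\
    m (\big[setU/set0]_(j <- s) S j) = \sum_(j <- s) m (S j).
  by move=> /(_ _ (index_enum_uniq J)) [].
elim=> [|j s IH]/=; first by rewrite !big_nil.
move=> /andP[js /IH[Gs ms]]; rewrite !big_cons; split; first exact: GU.
rewrite mU// ?ms// -subset0 -bigcup_seq => x [Sjx [i /= si Six]].
have ij : i = j by apply: tS => //; exists x.
by rewrite -ij si in js.
Qed.

Lemma measure_bigcup_finType (d : measure_display) (T : measurableType d)
    (R : realType) (m : {measure set T -> \bar R}) (J : finType)
    (B : J -> set T) :
  (forall j, measurable (B j)) -> trivIset setT B ->
  m (\bigcup_j B j) = (\sum_j m (B j))%E.
Proof.
apply: (@additive_bigcup _ _ measurable) => //; first exact: measurableU.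
by move=> A C mA mC AC; rewrite measureU.
Qed.

(** Each cell of a partition is dominated by the variation measure; conversely, cutting [A] by the
    Hahn sets [P] and [N] gives a partition that attains the bound. *)
Lemma tot_variation_charge (d : measure_display) (T : measurableType d)
    (R : realType) (sigma : {charge set T -> \bar R}) (P N : set T)
    (PN : hahn_decomposition sigma P N) (A : set T) :
  measurable A -> tot_variation sigma A = charge_variation PN A.
Proof.
move=> mA; have [[mP posP] [mN negN] PNT PN0] := PN.
apply/eqP; rewrite eq_le; apply/andP; split.
  apply: ge_ereal_sup => _ [k [B [mB tB BA ->]]].
  apply: le_trans (lee_sum _ (fun i _ => abse_charge_variation PN (mB i))) _.
  by rewrite -BA measure_bigcup_finType.
pose B b := A `&` (if b then P else N).
have mB b : measurable (B b) by apply: measurableI => //; case: b.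
have tB : trivIset setT B.
  move=> [] [] _ _ // [x []].
    by move=> [_ Px] [_ Nx]; have : (P `&` N) x by []; rewrite PN0.
  by move=> [_ Nx] [_ Px]; have : (P `&` N) x by []; rewrite PN0.
have BA : \bigcup_b B b = A.
  apply/seteqP; split => [x [b _ []]//|x Ax].
  by have : (P `|` N) x by [rewrite PNT]; case; [exists true|exists false].
have := tot_variation_ge sigma mB tB; rewrite BA; apply: le_trans.
rewrite big_bool/= /charge_variation/= jordan_posE jordan_negE.
rewrite cjordan_posE cjordan_negE /crestr0 mem_set// /crestr.
apply: leeD; first exact: lee_abs.
by rewrite -abseN lee_abs.
Qed.

(** For a fixed tagged partition [r], the value of [sigma] at the preimage of [S] is additive over
    all subsets [S], because these preimages are all measurable. It is bounded by the variation of
    [sigma], hence converges along an ultrafilter, and additivity and bounds survive in the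
    limit. *)
Lemma charge_extension (d : measure_display) (T : measurableType d)
    (R : realType) (sigma : {charge set T -> \bar R}) :
  exists nu : set T -> R, [/\
    forall A B, A `&` B = set0 -> nu (A `|` B) = nu A + nu B,
    forall A, measurable A -> (nu A)%:E = sigma A &
    forall (J : finType) (S : J -> set T) (C : set T),
      measurable C -> trivIset setT S -> (forall j, S j `<=` C) ->
      ((\sum_j `|nu (S j)|)%:E <= tot_variation sigma C)%E].
Proof.
have [P [N PN]] := Hahn_decomposition sigma.
pose var := charge_variation PN.
have var_fin A : measurable A -> var A \is a fin_num.
  by move=> mA; rewrite fin_num_measure.
have [U [UU rU]] := ultraFilterLemma (@retraction_filter_proper d T).
pose v S (r : T -> T) := fine (sigma (r @^-1` S)).
have Umeas : \forall r \near U, forall S, measurable (r @^-1` S).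
  exact/rU/retraction_filter_measurable.
have le_var A : measurable A -> (`|sigma A| <= var A)%E.
  exact: abse_charge_variation.
have sfin A : measurable A -> sigma A \is a fin_num.
  by move=> mA; exact: fin_num_measure.
have nu_ex S : exists l : R, v S @ U --> l.
  apply/cvg_ex/(@ultrafilter_cvg _ _ _ _ (fine (var setT))).
  apply: filterS Umeas => r mr.
  rewrite -fine_abse ?sfin// fine_le ?abse_fin_num ?sfin ?var_fin//.
  by apply: le_trans (le_var _ (mr S)) _; apply: le_measure; rewrite ?inE.
have [nu cv] := choice nu_ex.
have nu_eq S (f : (T -> T) -> R) l :
    (\forall r \near U, f r = v S r) -> f @ U --> l -> nu S = l.
  move=> fv fl; apply: (@cvg_unique _ (@Rhausdorff R) (v S @ U)); first exact: cv.
  exact: cvg_trans (near_eq_cvg fv) fl.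
exists nu; split.
- move=> A B AB; apply: (nu_eq _ (fun r => v A r + v B r)); last exact: cvgD.
  apply: filterS Umeas => r mr; rewrite /v -fineD ?sfin//.
  rewrite -chargeU ?preimage_setU//.
  by rewrite -preimage_setI AB preimage_set0.
- move=> A mA; rewrite (nu_eq A (fun=> fine (sigma A)) (fine (sigma A))).
  + by rewrite fineK ?sfin.
  + by apply: filterS (rU _ (retraction_filter_fix mA)) => r; rewrite /v => ->.
  + exact: cvg_cst.
- move=> J S C mC tS SC; rewrite (tot_variation_charge PN mC) -/var.
  rewrite -(fineK (var_fin _ mC)) lee_fin.
  have cs : \sum_j `|v (S j) r| @[r --> U] --> \sum_j `|nu (S j)|.
    by apply: cvg_big => [|j _]; [exact: add_continuous|exact: cvg_norm].
  apply: (cvgr_to_le cs).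
  (* Eventually [r] preserves [C], so the preimages of the [S j] are disjoint measurable subsets of
     [C], and the variation measure bounds their sum. *)
  apply: filterS2 Umeas (rU _ (retraction_filter_fix mC)) => r mr rC.
  rewrite -lee_fin fineK ?var_fin// -sumEFin.
  rewrite (eq_bigr (fun j => `|sigma (r @^-1` S j)|%E)) => [|j _]; last first.
    by rewrite -fine_abse ?sfin// fineK// abse_fin_num sfin.
  apply: le_trans (lee_sum _ (fun j _ => le_var _ (mr (S j)))) _.
  rewrite -measure_bigcup_finType//.
    rewrite le_measure ?inE//; first exact: fin_bigcup_measurable.
    by rewrite -rC => x [j _ /SC].
  by move=> i j _ _ [x [Six Sjx]]; apply: tS => //; exists (r x).
Qed.

(** * Integration of simple functions against finitely additive measures *)

Section simple_integral.
Context d (T : measurableType d) (R : realType).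
Implicit Types (m : set T -> R) (f g : T -> R) (J : finType).
Import HBSimple.

Definition finitely_additive m :=
  forall A B, measurable A -> measurable B -> A `&` B = set0 ->
    m (A `|` B) = m A + m B.

Definition measurable_fibers J (h : T -> J) :=
  forall j, measurable (h @^-1` [set j]).

(** Repeated values of [c] and empty cells of [h] are allowed, so that any two simple functions can
    be written over one partition. *)
Definition simple_fun f := exists (J : finType) (h : T -> J) (c : J -> R),
  measurable_fibers h /\ f = c \o h.

Definition sint m f : R := fine (sintegral (EFin \o m) f).

Lemma finitely_additive0 m : finitely_additive m -> m set0 = 0.
Proof.
move=> /(_ set0 set0 measurable0 measurable0 (setI0 _)).
by rewrite setU0 => /eqP; rewrite -subr_eq0 opprD addNKr oppr_eq0 => /eqP.
Qed.

Lemma finitely_additive_bigcup m J (S : J -> set T) :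
  finitely_additive m -> (forall j, measurable (S j)) -> trivIset setT S ->
  m (\bigcup_j S j) = \sum_j m (S j).
Proof.
move=> mU; apply: (@additive_bigcup _ _ measurable) => //.
  exact: measurableU.
exact: finitely_additive0.
Qed.

(** [sintegral] sums over values and the right side over cells: cells with a common value are merged
    by additivity, and values that [c] does not take contribute zero. *)
Lemma sintegral_comp (mu : set T -> \bar R) m J (h : T -> J) (c : J -> R) :
  finitely_additive m -> (forall A, measurable A -> mu A = (m A)%:E) ->
  measurable_fibers h ->
  sintegral mu (c \o h) = (\sum_j c j * m (h @^-1` [set j]))%:E.
Proof.
move=> madd muE mh; rewrite /sintegral.
have m_preim x : (c \o h) @^-1` [set x] =
    \bigcup_j (if c j == x then h @^-1` [set j] else set0).
  apply/seteqP; split => [t /= <-|t [j _]]; first by exists (h t); rewrite ?eqxx.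
  by case: eqP => // <- /= ->.
have mS x j : measurable (if c j == x then h @^-1` [set j] else set0).
  by case: ifP.
have mu_preim x : mu ((c \o h) @^-1` [set x]) =
    (\sum_j if c j == x then m (h @^-1` [set j]) else 0)%:E.
  rewrite muE ?m_preim; last exact: fin_bigcup_measurable.
  rewrite finitely_additive_bigcup//.
    congr EFin; apply: eq_bigr => j _; case: ifP => // _.
    exact: finitely_additive0.
  by move=> i j _ _ [t []]; do 2 case: ifP => //; move=> _ _ /= -> ->.
rewrite -(fsbig_widen [set` undup (codom c)] setT)//=; last first.
  move=> x [_ /= xc]; rewrite mu_preim big1 ?mule0// => j _.
  by case: eqP => // cj; case: xc; rewrite mem_undup -cj codom_f.
rewrite -fsbig_seq ?undup_uniq//.
under eq_bigr do rewrite mu_preim -EFinM.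
rewrite sumEFin; congr EFin.
rewrite (eq_bigr _ (fun x _ => mulr_sumr _ _ _ _))
  exchange_big/=; apply: eq_bigr => j _.
rewrite (bigD1_seq (c j)) ?undup_uniq ?mem_undup ?codom_f//= eqxx.
by rewrite big1 ?addr0// => x xj; rewrite eq_sym (negbTE xj) mulr0.
Qed.

Lemma sint_comp m J (h : T -> J) (c : J -> R) :
  finitely_additive m -> measurable_fibers h ->
  sint m (c \o h) = \sum_j c j * m (h @^-1` [set j]).
Proof. by move=> madd mh; rewrite /sint (@sintegral_comp _ m). Qed.

Lemma sintegral_sint (mu : set T -> \bar R) m f :
  finitely_additive m -> (forall A, measurable A -> mu A = (m A)%:E) ->
  simple_fun f -> sintegral mu f = (sint m f)%:E.
Proof.
move=> madd muE [J [h [c [mh ->]]]].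
by rewrite (sintegral_comp c madd muE mh) sint_comp.
Qed.

Lemma simple_fun_pair f g : simple_fun f -> simple_fun g ->
  exists (J : finType) (h : T -> J) (a b : J -> R),
    [/\ measurable_fibers h, f = a \o h & g = b \o h].
Proof.
move=> [I [h [a [mh ->]]]] [J [k [b [mk ->]]]].
exists (I * J)%type, (fun x => (h x, k x)), (a \o fst), (b \o snd).
split => // -[i j].
rewrite (_ : _ @^-1` _ = h @^-1` [set i] `&` k @^-1` [set j]).
  exact: measurableI.
by apply/seteqP; split => x /= [-> ->].
Qed.

Lemma simple_fun_comp2 (op : R -> R -> R) f g : simple_fun f -> simple_fun g ->
  simple_fun (fun x => op (f x) (g x)).
Proof.
move=> sf sg; have [J [h [a [b [mh -> ->]]]]] := simple_fun_pair sf sg.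
by exists J, h, (fun j => op (a j) (b j)).
Qed.

Lemma simple_fun_comp (op : R -> R) f : simple_fun f ->
  simple_fun (fun x => op (f x)).
Proof. by move=> sf; exact: (simple_fun_comp2 (fun a _ => op a) sf sf). Qed.

Lemma simple_fun_indic (A : set T) : measurable A -> simple_fun (\1_A : T -> R).
Proof.
move=> mA; exists bool, (fun x => x \in A), (fun b : bool => b%:R); split => //.
by move=> []; rewrite ?preimage_mem_true ?preimage_mem_false//;
  exact: measurableC.
Qed.

Lemma simple_fun_patch (A : set T) f : measurable A -> simple_fun f ->
  simple_fun (f \_ A).
Proof.
move=> mA sf; rewrite patch_indic.
exact: simple_fun_comp2 (simple_fun_indic mA).
Qed.

Lemma simple_fun_sfun (s : {sfun T >-> R}) : simple_fun s.
Proof.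
have /finite_seqP[r rE] := @fimfunP _ _ s.
have sr x : s x \in r by have : range s (s x) by []; rewrite rE.
exists (seq_sub r), (fun x => SeqSub (sr x)), (@ssval _ r); split => // j.
rewrite (_ : _ @^-1` _ = s @^-1` [set ssval j]); first exact: measurable_funPTI.
by apply/seteqP; split => x /= [H]; [rewrite -H|apply: val_inj].
Qed.

Lemma sintD m f g : finitely_additive m -> simple_fun f -> simple_fun g ->
  sint m (fun x => f x + g x) = sint m f + sint m g.
Proof.
move=> madd sf sg; have [J [h [a [b [mh -> ->]]]]] := simple_fun_pair sf sg.
rewrite !sint_comp// (@sint_comp _ _ _ (fun j => a j + b j))// -big_split/=.
by apply: eq_bigr => j _; rewrite mulrDl.
Qed.

Lemma sintZ m k f : finitely_additive m -> simple_fun f ->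
  sint m (fun x => k * f x) = k * sint m f.
Proof.
move=> madd [J [h [c [mh ->]]]].
rewrite sint_comp// (@sint_comp _ _ _ (fun j => k * c j))// big_distrr/=.
by apply: eq_bigr => j _; rewrite mulrA.
Qed.

Lemma sintB m f g : finitely_additive m -> simple_fun f -> simple_fun g ->
  sint m (fun x => f x - g x) = sint m f - sint m g.
Proof.
move=> madd sf sg; rewrite -[- sint m g]mulN1r -sintZ// -sintD//.
  by congr sint; apply/funext => x; rewrite mulN1r.
exact: (simple_fun_comp (fun a => -1 * a)).
Qed.

Lemma sint_indic m (A : set T) : finitely_additive m -> measurable A ->
  sint m \1_A = m A.
Proof.
move=> madd mA; rewrite /sint (_ : sintegral _ _ = (m A)%:E)//.
have -> : \1_A = (fun b : bool => b%:R) \o (fun x => x \in A) :> (T -> R) by [].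
rewrite (@sintegral_comp _ m)// => [|[]]; last 2 first.
- by rewrite preimage_mem_true.
- by rewrite preimage_mem_false; exact: measurableC.
by rewrite big_bool/= preimage_mem_true mul1r mul0r addr0.
Qed.

Lemma le_sint m f g : finitely_additive m ->
  (forall A, measurable A -> 0 <= m A) -> simple_fun f -> simple_fun g ->
  (forall x, f x <= g x) -> sint m f <= sint m g.
Proof.
move=> madd m0 sf sg fg.
have [J [h [a [b [mh fE gE]]]]] := simple_fun_pair sf sg.
rewrite fE gE !sint_comp//; apply: ler_sum => j _.
have [[x xj]|nj] := pselect (exists x, h x = j).
  rewrite ler_wpM2r ?m0//.
  by have := fg x; rewrite fE gE /= xj.
(* On an empty cell [a j <= b j] may fail, but the cell has measure zero. *)
rewrite (_ : h @^-1` _ = set0) ?finitely_additive0 ?mulr0//.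
by rewrite -subset0 => x xj; apply: nj; exists x.
Qed.

Lemma ler_norm_sint m v f : finitely_additive m -> finitely_additive v ->
  (forall A, measurable A -> `|m A| <= v A) -> simple_fun f ->
  `|sint m f| <= sint v (fun x => `|f x|).
Proof.
move=> madd vadd mv [J [h [c [mh ->]]]].
rewrite sint_comp// (@sint_comp _ _ _ (fun j => `|c j|))//.
apply: le_trans (ler_norm_sum _ _ _) _.
by apply: ler_sum => j _; rewrite normrM ler_wpM2l// mv.
Qed.

End simple_integral.

(** * Additivity of the total variation *)

Lemma le_tot_variation (d : measure_display) (T : measurableType d)
    (R : realType) (mu : set T -> \bar R) (A : set T) :
  measurable A -> (`|mu A| <= tot_variation mu A)%E.
Proof.
move=> mA; have := @tot_variation_ge _ _ _ mu unit (fun=> A) (fun=> mA).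
rewrite big_const card_unit/= adde0 bigcup_const; last by exists tt.
apply.
by move=> [] [].
Qed.

Lemma tot_variation_ge0 (d : measure_display) (T : measurableType d)
    (R : realType) (mu : set T -> \bar R) (A : set T) :
  measurable A -> (0 <= tot_variation mu A)%E.
Proof. by move=> mA; apply: le_trans (le_tot_variation mu mA). Qed.

Section tot_variation_additive.
Context d (T : measurableType d) (R : realType).
Variables (mu : set T -> \bar R) (m : set T -> R).
Hypothesis madd : finitely_additive m.
Hypothesis muE : forall A, measurable A -> mu A = (m A)%:E.
Hypothesis mu_fin : forall A, measurable A -> (tot_variation mu A < +oo)%E.

Lemma tot_variation_fin_num A :
  measurable A -> tot_variation mu A \is a fin_num.
Proof.
by move=> mA; rewrite ge0_fin_numE ?tot_variation_ge0// mu_fin.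
Qed.

(** Every partition of the union is cut along [A] and [B]; by the triangle inequality this does not
    decrease the sum. *)
Lemma tot_variation_setU_le A B : measurable A -> measurable B ->
  A `&` B = set0 ->
  (tot_variation mu (A `|` B) <= tot_variation mu A + tot_variation mu B)%E.
Proof.
move=> mA mB AB; apply: ge_ereal_sup => _ [k [S [mS tS SAB ->]]].
have part C : measurable C -> C `<=` A `|` B ->
    (\sum_(i < k) `|mu (S i `&` C)| <= tot_variation mu C)%E.
  move=> mC CAB; apply: ereal_sup_ubound.
  exists k, (fun i => S i `&` C); split => //.
  - by move=> i; exact: measurableI.
  - by move=> i j _ _ [x [[Si _] [Sj _]]]; apply: tS => //; exists x.
  - by rewrite -setI_bigcupl SAB; exact/setIidPr.
have partA := part _ mA (@subsetUl _ A B).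
have partB := part _ mB (@subsetUr _ A B).
apply: le_trans (leeD partA partB).
rewrite -big_split/=; apply: lee_sum => i _.
have SiE : S i = (S i `&` A) `|` (S i `&` B).
  by rewrite -setIUr; apply/esym/setIidPl; rewrite -SAB => x Sx; exists i.
have mSA : measurable (S i `&` A) by exact: measurableI.
have mSB : measurable (S i `&` B) by exact: measurableI.
rewrite {1}SiE !muE//; last exact: measurableU.
by rewrite madd ?lee_fin ?ler_normD// setIACA AB setI0.
Qed.

(** Partitions of [A] and [B] combine into one of the union, indexed by the sum type. Finiteness
    allows subtraction, so the two suprema are bounded one after the other. *)
Lemma tot_variation_setU_ge A B : measurable A -> measurable B ->
  A `&` B = set0 ->
  (tot_variation mu A + tot_variation mu B <= tot_variation mu (A `|` B))%E.
Proof.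
move=> mA mB AB.
rewrite -leeBrDr ?tot_variation_fin_num//.
apply: ge_ereal_sup => _ [k [S [mS tS SA ->]]].
have sS_fin : \sum_(i < k) `|mu (S i)|%E \is a fin_num.
  by apply/sum_fin_numP => i _ _; rewrite abse_fin_num muE.
rewrite leeBrDr ?tot_variation_fin_num// addeC -leeBrDr//.
apply: ge_ereal_sup => _ [l [S' [mS' tS' SB ->]]].
rewrite leeBrDr//.
pose S2 (x : 'I_k + 'I_l) := match x with inl i => S i | inr i => S' i end.
have mS2 x : measurable (S2 x) by case: x.
have tS2 : trivIset setT S2.
  have SAx i x : S i x -> A x by rewrite -SA => Six; exists i.
  have SBx i x : S' i x -> B x by rewrite -SB => Six; exists i.
  move=> [i|i] [j|j] _ _ [x []] /=.
  - by move=> Si Sj; congr inl; apply: tS => //; exists x.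
  - by move=> /SAx Ax /SBx Bx; have : (A `&` B) x by []; rewrite AB.
  - by move=> /SBx Bx /SAx Ax; have : (A `&` B) x by []; rewrite AB.
  - by move=> Si Sj; congr inr; apply: tS' => //; exists x.
have := tot_variation_ge mu mS2 tS2.
rewrite big_sumType/= addeC (_ : \bigcup_i S2 i = A `|` B)//.
rewrite -SA -SB; apply/seteqP; split => [x [[i|i] _ Six]|x [[i _ Six]|[i _ Six]]].
- by left; exists i.
- by right; exists i.
- by exists (inl i).
- by exists (inr i).
Qed.

Lemma tot_variation_additive :
  finitely_additive (fun A => fine (tot_variation mu A)).
Proof.
move=> A B mA mB AB; rewrite -fineD ?tot_variation_fin_num//; congr fine.
by apply/eqP; rewrite eq_le tot_variation_setU_le// tot_variation_setU_ge.
Qed.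

End tot_variation_additive.

(** * A criterion for integrability and for the value of the integral *)

Section ba_integral_criterion.
Context d (T : measurableType d) (R : realType).
Import HBSimple.

Lemma simple_fun_of_sfun (f : T -> R) : simple_fun f ->
  exists s : {sfun T >-> R}, f = s.
Proof.
move=> [J [h [c [mh fE]]]].
have mf : f \in mfun.
  rewrite inE/= => _ Y mY; rewrite setTI.
  rewrite (_ : f @^-1` Y = \bigcup_(j in [set j | Y (c j)]) h @^-1` [set j]).
    by apply: fin_bigcup_measurable => // j _; exact: mh.
  rewrite fE; apply/seteqP; split => [x Yx|x [j Yj] /= ->//].
  by exists (h x).
have ff : f \in fimfun.
  rewrite inE/=; apply: (@sub_finite_set _ _ (c @` setT)).
    by move=> _ [x _ <-]; rewrite fE; exists (h x).
  exact: finite_image.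
have sf : f \in sfun by rewrite inE/= mf ff.
by exists (sfun_Sub sf).
Qed.

Lemma simple_fun_bounded (f : T -> R) : simple_fun f ->
  exists2 M, 0 <= M & forall x, `|f x| <= M.
Proof.
move=> [J [h [c [_ ->]]]]; exists (\sum_j `|c j|); first exact: sumr_ge0.
by move=> x; rewrite (bigD1 (h x))//= lerDl sumr_ge0.
Qed.

Lemma sint_norm_patch_le (v : set T -> R) (Omega : set T) (f : T -> R) (a : R) :
  finitely_additive v -> (forall A, measurable A -> 0 <= v A) ->
  measurable Omega -> simple_fun f -> (forall x, Omega x -> `|f x| <= a) ->
  sint v ((fun x => `|f x|) \_ Omega) <= a * v Omega.
Proof.
move=> vadd v0 mO sf fa; rewrite -(sint_indic vadd mO) -sintZ//; last first.
  exact: simple_fun_indic.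
apply: le_sint => //.
- by apply: simple_fun_patch => //; exact: simple_fun_comp.
- exact/(simple_fun_comp (fun x => a * x))/simple_fun_indic.
- move=> x; rewrite patchE indicE; case: ifPn => [/set_mem/fa|_].
    by rewrite mulr1.
  by rewrite mulr0.
Qed.

Variables (Omega : set T) (mu : set T -> \bar R) (m : set T -> R).
Hypothesis mOmega : measurable Omega.
Hypothesis madd : finitely_additive m.
Hypothesis muE : forall A, measurable A -> mu A = (m A)%:E.
Hypothesis mu_fin : forall A, measurable A -> (tot_variation mu A < +oo)%E.

Let v A := fine (tot_variation mu A).

Let vadd : finitely_additive v.
Proof. exact: (tot_variation_additive madd muE mu_fin). Qed.

Let v_ge0 A : measurable A -> 0 <= v A.
Proof. by move=> mA; rewrite fine_ge0// tot_variation_ge0. Qed.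

Let vE A : measurable A -> tot_variation mu A = (v A)%:E.
Proof. by move=> mA; rewrite fineK// (tot_variation_fin_num mu_fin). Qed.

Let m_le_v A : measurable A -> `|m A| <= v A.
Proof.
move=> mA; rewrite -lee_fin -vE// -[leLHS]/(`|(m A)%:E|%E) -muE//.
exact: le_tot_variation.
Qed.

(** The exceptional sets are eventually empty, and two terms with errors below [a] differ by at most
    [2 * a] on [Omega]. *)
Lemma uniform_determining (f : T -> R) (s : nat -> {sfun T >-> R}) :
  (forall k x, Omega x -> `|s k x - f x| <= k.+1%:R^-1) ->
  determining Omega mu s f.
Proof.
move=> sf; split.
  move=> e e0; apply: cvg_near_cst.
  near=> k.
  rewrite (_ : _ `&` _ = set0); last first.
    rewrite -subset0 => x [Ox /=]; rewrite ltNge => /negP; apply.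
    apply: le_trans (sf _ _ Ox) _; apply: ltW.
    by near: k; exact: near_infty_natSinv_lt (PosNum e0).
  apply/eqP; rewrite eq_le; apply/andP; split.
    apply: ereal_inf_lbound; exists set0.
      by split => //; exact: measurable0.
    by rewrite vE// finitely_additive0.
  apply: le_ereal_inf_tmp => _ [A [mA _ _] <-]; exact: tot_variation_ge0.
move=> e e0.
have V1 : 0 < v Omega + 1 by rewrite ltr_wpDl// v_ge0.
(* Chosen so that [2 * a * v Omega < e]; the added 1 covers the case of zero variation. *)
pose a := e / (2 * (v Omega + 1)).
have a0 : 0 < a by rewrite divr_gt0// mulr_gt0.
have near_a : \forall k \near \oo, k.+1%:R^-1 < a.
  exact: near_infty_natSinv_lt (PosNum a0).
exists ([set k | k.+1%:R^-1 < a], [set k | k.+1%:R^-1 < a]); first by split.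
move=> [k l]/= [ka la].
rewrite (@sintegral_sint _ _ _ _ v)//; last first.
  apply: simple_fun_patch => //.
  exact: (simple_fun_comp2 (fun x y => `|x - y|)
    (simple_fun_sfun _) (simple_fun_sfun _)).
rewrite lte_fin; apply: (@le_lt_trans _ _ ((2 * a) * v Omega)).
  apply: (@sint_norm_patch_le _ _ (fun x => s k x - s l x)) => //.
    exact: (simple_fun_comp2 (fun x y => x - y) (simple_fun_sfun _)
      (simple_fun_sfun _)).
  move=> x Ox; rewrite (_ : _ - _ = (s k x - f x) - (s l x - f x)); last first.
    by rewrite opprB addrA subrK.
  apply: le_trans (ler_normB _ _) _.
  by rewrite mulr2n mulrDl !mul1r lerD// (le_trans (sf _ _ Ox))// ltW.
have -> : e = (2 * a) * (v Omega + 1) by rewrite /a; field; rewrite lt0r_neq0.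
by rewrite ltr_pM2l ?ltrDl// mulr_gt0.
Unshelve. all: by end_near.
Qed.

(** An arbitrary determining sequence [s] is compared in the mean with one approximant [t]. Where
    [s k] is near [f], it is near [t]; on the small exceptional set the distance is controlled
    through a fixed late term [s N], which is close to [s k] in the mean and at bounded distance
    from [t]. *)
Lemma ba_integral_isP (f : T -> R) (I C : R) : 0 <= C ->
  (forall e, 0 < e -> exists t : T -> R, [/\ simple_fun t,
     forall x, Omega x -> `|t x - f x| <= e &
     `|sint m (t \_ Omega) - I| <= C * e]) ->
  ba_integral_is Omega mu f I%:E.
Proof.
move=> C0 approx; split.
  have /choice[s sP] : forall k : nat, exists s : {sfun T >-> R},
      forall x, Omega x -> `|s x - f x| <= k.+1%:R^-1.
    move=> k; have [|t [/simple_fun_of_sfun[s ->] tf _]] := approx k.+1%:R^-1.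
      by rewrite invr_gt0.
    by exists s.
  by exists s; exact: uniform_determining.
move=> s [s_cvg s_cauchy].
have sE k : sintegral mu (s k \_ Omega) = (sint m (s k \_ Omega))%:E.
  apply: sintegral_sint => //; apply: simple_fun_patch => //.
  exact: simple_fun_sfun.
under eq_fun do rewrite sE.
apply: cvg_EFin; first exact: nearW.
apply/cvgrPdistC_le => e e0 /=.
pose K := C + 2 * v Omega + 2.
have K0 : 0 < K by rewrite ltr_wpDl// addr_ge0// mulr_ge0// v_ge0.
pose a := e / K.
have a0 : 0 < a by rewrite divr_gt0.
have [t [st tf tI]] := approx _ a0.
have [[A B] /= [[N _ NA] nB] AB] := s_cauchy _ a0.
have sNt : simple_fun (fun x => s N x - t x).
  exact: (simple_fun_comp2 (fun x y => x - y) (simple_fun_sfun _) st).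
(* [N] is fixed before [k], so [M] does not depend on [k] and the exceptional set can be required to
   have variation below [a / (M + 1)]. *)
have [M M0 sNM] := simple_fun_bounded sNt.
have aM : (0 < (a / (M + 1))%:E :> \bar R)%E.
  by rewrite lte_fin divr_gt0// ltr_wpDl.
have small : \forall k \near \oo,
   (outer_variation Omega mu
     (Omega `&` [set x | (a < `|s k x - f x|)%R]) < (a / (M + 1))%:E)%E.
  apply: (s_cvg _ a0 [set y | (y < (a / (M + 1))%:E)%E]).
  by apply: open_nbhs_nbhs; split => //; exact: open_ereal_lt_ereal.
apply: filterS2 small nB => k + Bk.
move=> /ereal_inf_lt[_ [D [mD DO OD] <-]]; rewrite vE// lte_fin => vD.
have cauchy_kN : sint v ((fun x => `|s N x - s k x|) \_ Omega) < a.
  rewrite -lte_fin -(@sintegral_sint _ _ _ (tot_variation mu))//.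
    by apply: (AB (N, k)); split; [apply: NA; exact: leqnn|].
  apply: simple_fun_patch => //.
  exact: (simple_fun_comp2 (fun x y => `|x - y|)
    (simple_fun_sfun _) (simple_fun_sfun _)).
(* A majorant of the distance from [s k] to [t] on [Omega]: the first term passes from [s k] to
   [s N], the second bounds [s N - t] on the exceptional set [D], and the third is the error off
   [D]. *)
pose g x := ((fun x => `|s N x - s k x|) \_ Omega) x +
  (M * \1_D x + 2 * a * \1_Omega x).
have sND : simple_fun (fun x => M * \1_D x).
  exact/(simple_fun_comp (fun x => M * x))/simple_fun_indic.
have sNO : simple_fun (fun x => 2 * a * \1_Omega x).
  exact/(simple_fun_comp (fun x => 2 * a * x))/simple_fun_indic.
have sNk : simple_fun ((fun x => `|s N x - s k x|) \_ Omega).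
  apply: simple_fun_patch => //.
  exact: (simple_fun_comp2 (fun x y => `|x - y|)
    (simple_fun_sfun _) (simple_fun_sfun _)).
have sD := simple_fun_comp2 +%R sND sNO.
have skO : simple_fun (s k \_ Omega).
  by apply: simple_fun_patch => //; exact: simple_fun_sfun.
have stO : simple_fun (t \_ Omega) by exact: simple_fun_patch.
have gE : sint v g = sint v ((fun x => `|s N x - s k x|) \_ Omega) +
    (M * v D + 2 * a * v Omega).
  rewrite sintD// sintD// !sintZ ?sint_indic//; exact: simple_fun_indic.
have dist_le_g x : `|(s k \_ Omega) x - (t \_ Omega) x| <= g x.
  rewrite /g !patchE !indicE; case: ifPn => [xO|_]; last first.
    by rewrite subrr normr0 mulr0 addr0 add0r mulr_ge0.
  rewrite mulr1; have Ox := set_mem xO.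
  have [xD|/negP xD] := boolP (x \in D).
    rewrite mulr1.
    rewrite (_ : s k x - t x = - (s N x - s k x) + (s N x - t x)); last first.
      by rewrite opprB addrA subrK.
    apply: le_trans (ler_normD _ _) _; rewrite normrN lerD2l.
    by apply: le_trans (sNM x) _; rewrite lerDl mulr_ge0// ltW.
  rewrite mulr0 add0r.
  have skf : `|s k x - f x| <= a.
    by rewrite leNgt; apply/negP => lt_a; apply/xD/mem_set/OD.
  rewrite (_ : s k x - t x = (s k x - f x) - (t x - f x)); last first.
    by rewrite opprB addrA subrK.
  apply: ler_wpDl => //; apply: le_trans (ler_normB _ _) _.
  by rewrite mulr2n mulrDl mul1r lerD// tf.
have -> : sint m (s k \_ Omega) - I =
    (sint m (s k \_ Omega) - sint m (t \_ Omega)) + (sint m (t \_ Omega) - I).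
  by rewrite addrA subrK.
apply: le_trans (ler_normD _ _) _.
(* The shares of the Cauchy estimate, of [D] (where [M * v D <= a]), of the points off [D], and of
   the approximation of [I]. Their coefficients add up to [K]. *)
have -> : e = (a + (a + 2 * a * v Omega)) + C * a.
  by rewrite /a; have := lt0r_neq0 K0; rewrite /K => ?; field.
apply: lerD => //; rewrite -sintB//.
have skt := simple_fun_comp2 (fun x y => x - y) skO stO.
apply: le_trans (ler_norm_sint madd vadd m_le_v skt) _.
have sg : simple_fun g by exact: (simple_fun_comp2 +%R sNk sD).
have norm_skt := simple_fun_comp2 (fun x y => `|x - y|) skO stO.
apply: le_trans (le_sint vadd v_ge0 norm_skt sg dist_le_g) _.
rewrite gE; apply: lerD; first exact: ltW.
rewrite lerD2r; apply: le_trans (ler_wpM2l M0 (ltW vD)) _.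
by rewrite mulrCA ler_piMr ?(ltW a0)// ler_pdivrMr ?mul1r ?lerDl// ltr_wpDl.
Qed.

End ba_integral_criterion.

(** * Approximation of integrals of continuous functions *)

Lemma closed_borel (R : realType) (n : nat) (K : set 'rV[R]_n) :
  closed K -> measurable (K : set (borelRn R n)).
Proof.
move=> cK; rewrite -(setCK K); apply: measurableC.
by apply: sub_sigma_algebra; exact: closed_openC.
Qed.

Lemma within_continuous_measurable (R : realType) (n : nat) (K : set 'rV[R]_n)
    (psi : 'rV[R]_n -> R) :
  closed K -> {within K, continuous psi} ->
  measurable_fun (K : set (borelRn R n)) psi.
Proof.
move=> cK /continuousP cpsi.
apply: (measurability _ (measurable_realfun.RGenOpens.measurableE R)).
move=> _ [_ [a [b ->] <-]].
have oab : open (`]a, b[%classic : set R) by exact: interval_open.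
have [V oV VE] := (open_subspaceP _ _).1 (cpsi _ oab).
rewrite setIC -VE; apply: measurableI; last exact: closed_borel.
exact: sub_sigma_algebra.
Qed.

Lemma compact_within_continuous_bounded (R : realType) (n : nat)
    (K : set 'rV[R]_n) (psi : 'rV[R]_n -> R) :
  compact K -> {within K, continuous psi} ->
  exists2 M, 0 <= M & forall x, K x -> `|psi x| <= M.
Proof.
move=> cK cpsi.
have /compact_bounded[M [_ MP]] := continuous_compact cpsi cK.
exists (`|M| + 1) => [|x Kx]; first by rewrite addr_ge0.
apply: (MP (`|M| + 1)); first by rewrite (le_lt_trans (ler_norm _))// ltrDl.
by exists x.
Qed.

(** On [K], [psi] is rounded down to the grid of step [e] that starts at its lower bound [- M]. *)
Lemma simple_fun_approx (R : realType) (n : nat) (K : set 'rV[R]_n)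
    (psi : 'rV[R]_n -> R) (e : R) :
  compact K -> {within K, continuous psi} -> 0 < e ->
  exists t : borelRn R n -> R,
    simple_fun t /\ forall x, K x -> `|t x - psi x| <= e.
Proof.
move=> coK cpsi e0.
have cK : closed K by apply: compact_closed => //; exact: norm_hausdorff.
have mpsi := within_continuous_measurable cK cpsi.
have mK := closed_borel cK.
have [M M0 psiM] := compact_within_continuous_bounded coK cpsi.
pose k x := Num.truncn ((psi x + M) / e).
have arg_ge0 x : K x -> 0 <= (psi x + M) / e.
  move=> /psiM; rewrite ler_norml => /andP[Mpsi _].
  by rewrite divr_ge0 ?(ltW e0)// -lerBlDr sub0r.
pose N := Num.truncn ((M + M) / e).
have kN x : K x -> (k x < N.+1)%N.
  move=> Kx; rewrite ltnS; apply: le_truncn.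
  rewrite ler_pM2r ?invr_gt0// lerD2r.
  by have := psiM x Kx; rewrite ler_norml => /andP[].
(* Outside [K], where nothing is claimed, [ord0] is a default; this is why its fibre below also
   contains the complement of [K]. *)
pose h (x : borelRn R n) : 'I_N.+1 := if x \in K then inord (k x) else ord0.
pose c (j : 'I_N.+1) : R := j%:R * e - M.
exists (c \o h); split; last first.
  move=> x Kx; rewrite /c /h /= mem_set// inordK ?kN//.
  have /andP[kl ku] := truncn_itv (arg_ge0 _ Kx); rewrite -/(k x) in kl ku.
  have {}kl : (k x)%:R * e <= psi x + M by rewrite -ler_pdivlMr.
  have {}ku : psi x + M < (k x).+1%:R * e by rewrite -ltr_pdivrMr.
  rewrite -natr1 in ku.
  rewrite ler_norml; apply/andP; split; lra.
exists 'I_N.+1, h, c; split => // j.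
have -> : h @^-1` [set j] =
    (K `&` psi @^-1` `[j%:R * e - M, j.+1%:R * e - M[%classic) `|`
    (if j == ord0 then ~` K else set0).
  apply/seteqP; split => x; rewrite /h /=.
    case: ifPn => [/set_mem Kx kj|/negP xK <-]; last first.
      by right; rewrite eqxx => Kx; apply: xK; exact: mem_set.
    left; split => //; have /andP[] := truncn_itv (arg_ge0 _ Kx).
    rewrite -/(k x) -kj inordK ?kN//= in_itv/= => kl ku.
    by rewrite lerBlDr ltrBrDr -ler_pdivlMr// -ltr_pdivrMr// kl ku.
  move=> [[Kx]|]; rewrite /= ?in_itv/=.
    rewrite mem_set// lerBlDr ltrBrDr -ler_pdivlMr// -ltr_pdivrMr// => jk.
    by apply: val_inj; rewrite /= inordK ?kN//; exact: truncn_def.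
  by case: eqP => // -> nKx; rewrite ifN//; apply/negP => /set_mem.
apply: measurableU; last by case: ifP => // _; exact: measurableC.
exact: mpsi.
Qed.

Lemma integral_near_cst (d : measure_display) (T : measurableType d)
    (R : realType) (p : {finite_measure set T -> \bar R}) (A : set T)
    (f : T -> R) (c e : R) :
  measurable A -> measurable_fun A f -> (forall x, A x -> `|c - f x| <= e) ->
  exists2 r, (\int[p]_(x in A) (f x)%:E)%E = r%:E &
    `|c * fine (p A) - r| <= e * fine (p A).
Proof.
move=> mA mf fc.
have pA : p A = (fine (p A))%:E by rewrite fineK// fin_num_measure.
have f_int : p.-integrable A (EFin \o f).
  apply: measurable_bounded_integrable => //.
    by rewrite ltey_eq fin_num_measure.
  exists (`|c| + e); split; first exact: num_real.
  move=> M Mgt x Ax /=; apply: ltW; apply: le_lt_trans Mgt.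
  rewrite (_ : f x = c - (c - f x)); last by rewrite opprB addrC subrK.
  by apply: le_trans (ler_normB _ _) _; rewrite lerD2l fc.
have cst_int r : p.-integrable A (EFin \o cst r).
  by apply: finite_measure_integrable_cst.
have lo : ((c - e)%:E * p A <= \int[p]_(x in A) (f x)%:E)%E.
  rewrite -integral_cst//; apply: le_integral => //; first exact: cst_int.
  by move=> x /set_mem/fc; rewrite lee_fin ler_norml => /andP[]; lra.
have hi : (\int[p]_(x in A) (f x)%:E <= (c + e)%:E * p A)%E.
  rewrite -integral_cst//; apply: le_integral => //; first exact: cst_int.
  by move=> x /set_mem/fc; rewrite lee_fin ler_norml => /andP[]; lra.
have f_fin : (\int[p]_(x in A) (f x)%:E)%E \is a fin_num.
  exact: integrable_fin_num.
exists (fine (\int[p]_(x in A) (f x)%:E)%E); first by rewrite fineK.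
move: lo hi; rewrite -{1 2}(fineK f_fin) pA -!EFinM !lee_fin /=.
by rewrite ler_norml mulrBl mulrDl => lo hi; apply/andP; split; lra.
Qed.

(** The estimate for a constant is applied on each cell of [F]; the errors, [e] times the measure of
    a cell, add up. *)
Lemma integral_near_simple (d : measure_display) (T : measurableType d)
    (R : realType) (p : {finite_measure set T -> \bar R}) (F : set T)
    (f : T -> R) (J : finType) (h : T -> J) (c : J -> R) (e : R) :
  measurable F -> measurable_fun F f -> measurable_fibers h ->
  (forall x, F x -> `|c (h x) - f x| <= e) ->
  exists2 r, (\int[p]_(x in F) (f x)%:E)%E = r%:E &
    `|\sum_j c j * fine (p (F `&` h @^-1` [set j])) - r| <= e * fine (p F).
Proof.
move=> mF mf mh fc.
pose G j := F `&` h @^-1` [set j].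
have mG j : measurable (G j) by apply: measurableI => //; exact: mh.
have GF : \bigcup_j G j = F.
  by apply/seteqP; split => [x [j _ []]//|x Fx]; exists (h x).
have tG : trivIset setT G by move=> i j _ _ [x [[_ <-] [_ <-]]].
have piece j : exists r, (\int[p]_(x in G j) (f x)%:E)%E = r%:E /\
    `|c j * fine (p (G j)) - r| <= e * fine (p (G j)).
  have [||r rE rc] := @integral_near_cst _ _ _ p (G j) f (c j) e (mG j).
  - by apply: measurable_funS mf => // x [].
  - by move=> x [Fx <-]; exact: fc.
  - by exists r.
have [r rP] := choice piece.
exists (\sum_j r j).
  rewrite -GF -sumEFin (eq_bigr _ (fun j _ => esym (rP j).1)).
  rewrite (_ : \bigcup_j G j = \big[setU/set0]_(j <- index_enum J) G j).
    apply: integral_bigsetU_EFin => //; first exact: index_enum_uniq.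
      by apply: sub_trivIset tG.
    apply/measurable_realfun.measurable_EFinP; apply: measurable_funS mf => //.
    by rewrite -bigcup_seq => x [j _ []].
  rewrite -bigcup_seq; congr bigcup.
  by apply/seteqP; split => j //= _; rewrite mem_index_enum.
rewrite -sumrB; apply: le_trans (ler_norm_sum _ _ _) _.
apply: le_trans (ler_sum _ (fun j _ => (rP j).2)) _.
rewrite -mulr_sumr -GF measure_bigcup_finType//.
by rewrite sum_fine// => j _; exact: fin_num_measure.
Qed.

(** The estimate is applied to both Jordan parts of [sigma], and the two errors add up to [e] times
    the variation. *)
Lemma charge_integral_near_simple (d : measure_display) (T : measurableType d)
    (R : realType) (sigma : {charge set T -> \bar R}) (F : set T)
    (f : T -> R) (J : finType) (h : T -> J) (c : J -> R) (e : R) :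
  measurable F -> measurable_fun F f -> measurable_fibers h ->
  (forall x, F x -> `|c (h x) - f x| <= e) ->
  exists2 r, charge_integral sigma F f = r%:E &
    `|\sum_j c j * fine (sigma (F `&` h @^-1` [set j])) - r| <=
      e * fine (tot_variation sigma F).
Proof.
move=> mF mf mh fc; rewrite /charge_integral.
set PN := proj2_sig (hahn_sets sigma).
have [r1 -> r1c] := integral_near_simple (jordan_pos PN) mF mf mh fc.
have [r2 -> r2c] := integral_near_simple (jordan_neg PN) mF mf mh fc.
exists (r1 - r2); first by rewrite EFinB.
have sigmaE A : measurable A ->
    fine (sigma A) = fine (jordan_pos PN A) - fine (jordan_neg PN A).
  move=> mA; rewrite (jordan_decomp PN mA) /cadd/= cscaleN1.
  by rewrite fineB ?fin_num_measure.
rewrite (tot_variation_charge PN)// /charge_variation fineD ?fin_num_measure//.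
under eq_bigr => j _.
  rewrite sigmaE; last by apply: measurableI => //; exact: mh.
  rewrite mulrBr.
  over.
rewrite sumrB; move: r1c r2c; set s1 := \sum_j _; set s2 := \sum_j _ => r1c r2c.
rewrite (_ : _ - _ = (s1 - r1) - (s2 - r2)); last by ring.
by rewrite mulrDr; apply: le_trans (ler_normB _ _) (lerD _ _).
Qed.

Lemma additive_charge_of_finitely_additive (d : measure_display)
    (T : measurableType d) (R : realType) (m : set T -> R) :
  finitely_additive m ->
  exists mu : {additive_charge set T -> \bar R}, forall B, mu B = (m B)%:E.
Proof.
move=> madd; pose mu B := (m B)%:E.
have mu_add : measure_function.semi_additive mu.
  move=> S k mS tS _; rewrite /mu sumEFin; congr EFin.
  rewrite -(@finitely_additive_bigcup _ _ _ m 'I_k) //.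
    congr m; rewrite -bigcup_mkord.
    apply/seteqP; split => [x [i ik Six]|x [i _ Six]]; last by exists i => /=.
    by exists (Ordinal ik).
  by move=> i j _ _ /(tS _ _ I I) /val_inj.
have mu_fin : fin_num_fun mu by move=> B _.
pose a := isAdditiveCharge.Build d T R mu mu_add.
pose b := isFinite.Build d T R mu mu_fin.
by exists (HB.pack_for (additive_charge T R) mu a b).
Qed.

(* The two sums are compared on the common refinement of the two partitions. *)
Lemma additive_partition_dist (T : Type) (R : realDomainType) (nu : set T -> R)
    (F : set T) (e V : R) (I J : finType) (S : I -> set T) (G : J -> set T)
    (a : I -> R) (b : J -> R) :
  (forall A B, A `&` B = set0 -> nu (A `|` B) = nu A + nu B) ->
  (forall (K : finType) (H : K -> set T), trivIset setT H ->
    (forall k, H k `<=` F) -> \sum_k `|nu (H k)| <= V) ->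
  0 <= e -> trivIset setT S -> trivIset setT G ->
  \bigcup_i S i = F -> \bigcup_j G j = F ->
  (forall i j x, S i x -> G j x -> `|a i - b j| <= e) ->
  `|\sum_i a i * nu (S i) - \sum_j b j * nu (G j)| <= e * V.
Proof.
move=> nuU nuV e0 tS tG SF GF ab.
have nu0 : nu set0 = 0.
  have := nuU set0 set0 (setI0 _); rewrite setU0 => /eqP.
  by rewrite -subr_eq0 opprD addNKr oppr_eq0 => /eqP.
have nu_bigcup (K : finType) (H : K -> set T) :
    trivIset setT H -> nu (\bigcup_k H k) = \sum_k nu (H k).
  by apply: (@additive_bigcup _ _ setT) => // A B _ _; exact: nuU.
have nuS i : nu (S i) = \sum_j nu (S i `&` G j).
  rewrite -nu_bigcup.
    by rewrite -setI_bigcupr GF setIidl// -SF; exact: bigcup_sup.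
  by move=> j k _ _ [x [[_ Gj] [_ Gk]]]; apply: tG => //; exists x.
have nuG j : nu (G j) = \sum_i nu (S i `&` G j).
  rewrite -nu_bigcup.
    by rewrite -setI_bigcupl SF setIidr// -GF; exact: bigcup_sup.
  by move=> i k _ _ [x [[Si _] [Sk _]]]; apply: tS => //; exists x.
have -> : \sum_i a i * nu (S i) =
    \sum_(p : I * J) a p.1 * nu (S p.1 `&` G p.2).
  by rewrite -(pair_bigA _ (fun i j => a i * nu (S i `&` G j)))/=;
    apply: eq_bigr => i _; rewrite nuS mulr_sumr.
have -> : \sum_j b j * nu (G j) =
    \sum_(p : I * J) b p.2 * nu (S p.1 `&` G p.2).
  rewrite -(pair_bigA _ (fun i j => b j * nu (S i `&` G j)))/= exchange_big/=.
  by apply: eq_bigr => j _; rewrite nuG mulr_sumr.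
rewrite -sumrB; apply: le_trans (ler_norm_sum _ _ _) _.
apply: (@le_trans _ _ (\sum_(p : I * J) e * `|nu (S p.1 `&` G p.2)|)).
  apply: ler_sum => -[i j] _ /=; rewrite -mulrBl normrM.
  have [[x [Six Gjx]]|nSG] := pselect (S i `&` G j !=set0).
    by rewrite ler_wpM2r// (ab i j x).
  suff -> : S i `&` G j = set0 by rewrite nu0 normr0 !mulr0.
  by apply/eqP; apply: contra_notT nSG => /set0P.
rewrite -mulr_sumr ler_wpM2l//; apply: nuV.
  move=> [i j] [k l] _ _ [x [[/= Si Gj] [Sk Gl]]]; congr pair.
    by apply: tS => //; exists x.
  by apply: tG => //; exists x.
by move=> [i j] x [/= Six _]; rewrite -SF; exists i.
Qed.

(** * The transported measure *)

Lemma ultrafilter_meets (T : Type) (U : set_system T) (A B : set T) :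
  UltraFilter U -> U A -> U B -> A `&` B !=set0.
Proof. by move=> UU UA UB; exact: (filter_ex (filterI UA UB)). Qed.

Section concentrated_charge.
Context (R : realType) (n : nat).
Variables (Omega F : set 'rV[R]_n) (U : 'rV[R]_n -> set_system 'rV[R]_n).
Variables (sigma : {charge set (borelRn R n) -> \bar R}).
Variables (nu : set (borelRn R n) -> R).
Variables (mu : {additive_charge set (borelRn R n) -> \bar R}).

(** Nothing makes this set Borel, since the ultrafilters are chosen independently at each point;
    hence the need for [nu] on all subsets. *)
Definition ultra_trace (B : set 'rV[R]_n) : set 'rV[R]_n :=
  [set x | F x /\ U x B].

Hypothesis Omega_borel : borel Omega.
Hypothesis F_sub : F `<=` closure Omega.
Hypothesis F_closed : closed F.
Hypothesis U_ultra : forall x, F x -> UltraFilter (U x).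
Hypothesis U_nbhs : forall x, F x -> nbhs x `<=` U x.
Hypothesis U_Omega : forall x, F x -> U x Omega.
Hypothesis U_null : forall x, F x ->
  forall B, (lebesgue_Rn B <= 0)%E -> U x (~` B).
Hypothesis nuU : forall A B, A `&` B = set0 -> nu (A `|` B) = nu A + nu B.
Hypothesis nu_sigma : forall A, measurable A -> (nu A)%:E = sigma A.
Hypothesis nu_le : forall (J : finType) (S : J -> set (borelRn R n)) C,
  measurable C -> trivIset setT S -> (forall j, S j `<=` C) ->
  ((\sum_j `|nu (S j)|)%:E <= tot_variation sigma C)%E.
Hypothesis muE : forall B, mu B = (nu (ultra_trace B))%:E.

Let mF : measurable (F : set (borelRn R n)).
Proof. exact: closed_borel F_closed. Qed.

Let sigma_fin A : measurable A -> tot_variation sigma A \is a fin_num.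
Proof.
move=> mA; have [P [N PN]] := Hahn_decomposition sigma.
by rewrite (tot_variation_charge PN)// fin_num_measure.
Qed.

Let V := fine (tot_variation sigma F).

Let V_ge0 : 0 <= V.
Proof. by rewrite fine_ge0// tot_variation_ge0. Qed.

Let nu0 : nu set0 = 0.
Proof.
have := nuU (setI0 set0); rewrite setU0 => /eqP.
by rewrite -subr_eq0 opprD addNKr oppr_eq0 => /eqP.
Qed.

Let nu_le_V (J : finType) (S : J -> set (borelRn R n)) :
  trivIset setT S -> (forall j, S j `<=` F) -> \sum_j `|nu (S j)| <= V.
Proof.
by move=> tS SF; rewrite -lee_fin fineK ?sigma_fin//; exact: nu_le.
Qed.

Let nu_norm_le (S C : set (borelRn R n)) : measurable C -> S `<=` C ->
  (`|nu S|%:E <= tot_variation sigma C)%E.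
Proof.
move=> mC SC; have := @nu_le unit (fun=> S) C mC.
rewrite big_const card_unit/= addr0; apply => //.
by move=> [] [].
Qed.

Lemma ultra_trace_disjoint A B : A `&` B = set0 ->
  ultra_trace A `&` ultra_trace B = set0.
Proof.
move=> AB; rewrite -subset0 => x [[Fx UA] [_ UB]].
have [y] := ultrafilter_meets (U_ultra Fx) UA UB.
by rewrite AB.
Qed.

(** The inclusion from left to right needs an ultrafilter: one that contains a union contains one of
    its two members. *)
Lemma ultra_trace_setU A B :
  ultra_trace (A `|` B) = ultra_trace A `|` ultra_trace B.
Proof.
apply/seteqP; split => x.
  move=> [Fx UAB]; have UU := U_ultra Fx.
  have [UA|UnA] := in_ultra_setVsetC A UU; first by left.
  right; split => //; apply: filterS2 UAB UnA => y.
  by case.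
move=> [] [Fx UA]; split => //; have UU := U_ultra Fx.
  by apply: filterS UA => y; left.
by apply: filterS UA => y; right.
Qed.

Lemma ultra_trace_trivIset (J : finType) (S : J -> set 'rV[R]_n) :
  trivIset setT S -> trivIset setT (fun j => ultra_trace (S j)).
Proof.
move=> tS i j _ _ [x [[Fx Ui] [_ Uj]]]; apply: tS => //.
exact: ultrafilter_meets (U_ultra Fx) Ui Uj.
Qed.

(** An ultrafilter contains a cell of every finite partition; otherwise it would contain the
    finitely many complements and their empty intersection. *)
Lemma ultra_trace_fibers (J : finType) (h : 'rV[R]_n -> J) :
  \bigcup_j ultra_trace (h @^-1` [set j]) = F.
Proof.
apply/seteqP; split => [x [j _ []]//|x Fx].
have UU := U_ultra Fx.
have [[j Uj]|/forallNP nU] := pselect (exists j, U x (h @^-1` [set j])).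
  by exists j.
have UnS j : \forall y \near U x, h y <> j.
  by have [/nU//|] := in_ultra_setVsetC (h @^-1` [set j]) UU.
by have [y /(_ (h y))] := filter_ex (filter_forall _ UnS).
Qed.

Lemma ultra_trace_out A : A `&` Omega = set0 -> ultra_trace A = set0.
Proof.
move=> AO; rewrite -subset0 => x [Fx UA].
have [y] := ultrafilter_meets (U_ultra Fx) UA (U_Omega Fx).
by rewrite AO.
Qed.

Lemma ultra_trace_Omega : ultra_trace Omega = F.
Proof. by apply/seteqP; split => [x []//|x Fx]; split => //; exact: U_Omega. Qed.

Let m (B : set (borelRn R n)) : R := nu (ultra_trace B).

Let madd : finitely_additive m.
Proof.
move=> A B _ _ AB; rewrite /m ultra_trace_setU nuU//.
exact: ultra_trace_disjoint.
Qed.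

Let mu_tot_le A : (tot_variation mu A <= V%:E)%E.
Proof.
apply: ge_ereal_sup => _ [k [S [mS tS _ ->]]].
under eq_bigr do rewrite muE.
rewrite sumEFin lee_fin; apply: nu_le_V; first exact: ultra_trace_trivIset.
by move=> j x [].
Qed.

(** Null sets and sets disjoint from [Omega] belong to no [U x] with [x] in [F], so their traces are
    empty. The bound is the variation of [sigma] on [F]. *)
Lemma concentrated_charge_is_ba : is_ba Omega mu.
Proof.
split.
- move=> B _ OB; rewrite muE ultra_trace_out ?nu0//.
  by rewrite setIC.
- exists V => B mB _.
  by apply: le_trans (le_tot_variation mu mB) (mu_tot_le B).
- move=> B _ _ B0; rewrite muE (_ : ultra_trace B = set0) ?nu0//.
  rewrite -subset0 => x [Fx UB].
  have UnB : U x (~` B) by apply: U_null => //; rewrite B0.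
  by have [y []] := ultrafilter_meets (U_ultra Fx) UB UnB.
Qed.

Lemma concentrated_charge_core : core Omega mu `<=` F.
Proof.
move=> x xcore; apply: contrapT => nFx.
have /nbhs_ballP[e /= e0 eF] : nbhs x (~` F).
  by apply: open_nbhs_nbhs; split => //; exact: closed_openC.
(* Half the radius: the half ball around a point [y] of [F] then misses [W], so no subset of [W]
   belongs to [U y]. *)
have e20 : 0 < e / 2 by rewrite divr_gt0.
pose W := (ball x (e / 2))°.
have oW : open W by exact: open_interior.
have Wx : W x by exact: nbhsx_ballx.
have := xcore _ oW Wx; rewrite ltNge => /negP; apply.
apply: ge_ereal_sup => _ [k [S [_ _ SW ->]]].
rewrite big1// => i _; rewrite muE (_ : ultra_trace _ = set0).
  by rewrite nu0 abse0.
rewrite -subset0 => y [Fy Uy].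
have Uball : U y (ball y (e / 2)) by apply: U_nbhs => //; exact: nbhsx_ballx.
have [z [Siz yz]] := ultrafilter_meets (U_ultra Fy) Uy Uball.
have [Wz _] : (W `&` Omega) z by rewrite -SW; exists i.
apply: (eF y) => //; apply: (@ball_split _ _ z).
  exact: interior_subset Wz.
exact: ball_sym.
Qed.

(** A simple [t] near [psi] yields two sums, one over the traces of the cells of [t] restricted to
    [Omega], one over the cells of [t] inside [F]. Both families partition [F], and coefficients at
    a common point [x] are close because [psi] tends to [psi x] along [U x] within [Omega]. *)
Lemma concentrated_charge_integral (phi psi : 'rV[R]_n -> R) :
  compact (closure Omega) -> Ce_extension Omega phi psi ->
  ba_integral_is (Omega : set (borelRn R n)) mu phi
    (charge_integral sigma F psi).
Proof.
move=> cO [_ cpsi psi_phi].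
have mpsi : measurable_fun (F : set (borelRn R n)) psi.
  have cl := @closed_closure _ Omega.
  exact: measurable_funS (closed_borel cl) F_sub
    (within_continuous_measurable cl cpsi).
have step e (t : borelRn R n -> R) : 0 < e -> simple_fun t ->
    (forall x, closure Omega x -> `|t x - psi x| <= e) ->
    exists2 r, charge_integral sigma F psi = r%:E &
      `|sint m (t \_ Omega) - r| <= 4 * V * e.
  move=> e0 st tpsi.
  have [J [h [c [mh tE]]]] := st.
  have [|r rE hr] :=
      @charge_integral_near_simple _ _ _ sigma F psi J h c e mF mpsi mh.
    by move=> x /F_sub/tpsi; rewrite tE.
  exists r => //.
  have [I [k [a [mk taE]]]] := simple_fun_patch Omega_borel st.
  rewrite taE sint_comp//.
  have sigma_nu : \sum_j c j * fine (sigma (F `&` h @^-1` [set j])) =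
      \sum_j c j * nu (F `&` h @^-1` [set j]).
    apply: eq_bigr => j _; rewrite -nu_sigma//.
    by apply: measurableI => //; exact: mh.
  rewrite -(subrK (\sum_j c j * nu (F `&` h @^-1` [set j])) (\sum_i _)).
  rewrite -addrA; rewrite sigma_nu in hr.
  apply: le_trans (ler_normD _ _) _.
  (* [3 * e] bounds the difference of coefficients over the two partitions; the last [e * V] is the
     error in the integral against [sigma]. *)
  rewrite (_ : 4 * V * e = 3 * e * V + e * V); last by ring.
  apply: lerD => //; apply: (@additive_partition_dist _ _ nu F) => //.
  + by rewrite mulr_ge0// ltW.
  + by apply: ultra_trace_trivIset => i j _ _ [x [<- <-]].
  + by move=> i j _ _ [x [[_ <-] [_ <-]]].
  + exact: ultra_trace_fibers.
  + by apply/seteqP; split => [x [j _ []]//|x Fx]; exists (h x).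
  move=> i j x [Fx Ui] [_ /= hx].
  have UU := U_ultra Fx.
  have Upsi : U x [set y | closure Omega y -> `|psi y - psi x| <= e].
    apply: U_nbhs => //.
    have /subspace_continuousP/(_ x (F_sub Fx)) := cpsi.
    by move=> /cvgrPdistC_le/(_ _ e0).
  (* [y] links the coefficients [a i = t y] and [c j = t x]: its value under [psi] is within [e] of
     [psi x]. *)
  have [y [[Oy /= ky] ypsi]] : (Omega `&` k @^-1` [set i]) `&`
      [set y | closure Omega y -> `|psi y - psi x| <= e] !=set0.
    exact: filter_ex (filterI (filterI (U_Omega Fx) Ui) Upsi).
  have cOy : closure Omega y by exact: subset_closure.
  have aE : a i = t y.
    by have := congr1 (@^~ y) taE; rewrite patchE mem_set//= ky.
  have cE : c j = t x by rewrite tE /= hx.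
  rewrite aE cE (_ : t y - t x =
    (t y - psi y) + ((psi y - psi x) - (t x - psi x))); last by ring.
  apply: le_trans (ler_normD _ _) _.
  rewrite (_ : 3 * e = e + (e + e)); last by ring.
  apply: lerD; first exact: tpsi.
  apply: le_trans (ler_normB _ _) _; apply: lerD; first exact: ypsi.
  exact/tpsi/F_sub.
(* Tolerance 1 serves only to name the finite value [r] of the integral. *)
have [t [st tpsi]] := simple_fun_approx cO cpsi ltr01.
have [r rE _] := step _ _ ltr01 st tpsi.
rewrite rE; apply: (@ba_integral_isP _ _ _ _ _ m _ _ _ _ _ _ (4 * V)) => //.
- by move=> A mA; apply: le_lt_trans (mu_tot_le A) (ltry _).
- by rewrite mulr_ge0.
move=> e e0; have [s [ss spsi]] := simple_fun_approx cO cpsi e0.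
exists s; split => //.
  by move=> x Ox; rewrite -psi_phi//; apply: spsi; exact: subset_closure.
have [r' + rs] := step _ _ e0 ss spsi.
by rewrite rE => -[->].
Qed.

(** For the lower bound, [Omega] is split into two Borel sets whose traces nearly have the
    [nu]-values of the positive and negative Hahn parts of [F]. The splitting set [D] is open and
    squeezed between the [K] and [W] given by regularity. *)
Lemma concentrated_charge_variation : radon_on F sigma ->
  tot_variation mu Omega = tot_variation sigma F.
Proof.
move=> [_ sigma_reg].
rewrite -(fineK (sigma_fin mF)) -/V; apply/eqP; rewrite eq_le mu_tot_le/=.
have [P [N PN]] := Hahn_decomposition sigma.
have [[mP _] _ _ _] := PN.
pose A := F `&` P.
have mA : measurable (A : set (borelRn R n)) by exact: measurableI.
have VE : V = nu A - (nu F - nu A).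
  have [_ [mN _] PNT PN0] := PN.
  have mFN : measurable (F `&` N : set (borelRn R n)) by exact: measurableI.
  have -> : nu F = nu A + nu (F `&` N).
    rewrite -nuU; first by rewrite -setIUr PNT setIT.
    by rewrite setIACA PN0 setI0.
  rewrite /V (tot_variation_charge PN)// /charge_variation/=.
  rewrite jordan_posE jordan_negE cjordan_posE cjordan_negE /crestr0 mem_set//.
  by rewrite /crestr -!nu_sigma//= addrAC subrr add0r.
apply/lee_addgt0Pr => e e0.
(* [nu A] and [nu (ultra_trace B1)] each differ from [nu K] by at most [e / 4], and the resulting
   error [e / 2] counts twice at the end. *)
have e40 : 0 < e / 4 by rewrite divr_gt0.
have [K [W [cK oW KA AW WK]]] := sigma_reg A _ mA e40.
have clK : closed K by apply: compact_closed => //; exact: norm_hausdorff.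
(* Normality gives room between [D] and [W]: a point outside [W] has a neighbourhood that misses
   [D], so it is not in the trace of [B1]. *)
have [D [oO KO OW]] : exists D, [/\ open D, K `<=` D & closure D `<=` W].
  have nKW : set_nbhs K W by apply/set_nbhsP; exists W; split => // x /KA/AW.
  have [Q /set_nbhsP[D [oO KO OQ]] QW] := pseudometric_normal clK nKW.
  by exists D; split => //; exact: subset_trans (closureS OQ) QW.
pose B1 : set (borelRn R n) := D `&` Omega.
pose B2 : set (borelRn R n) := Omega `\` D.
have mO : borel D by exact: sub_sigma_algebra.
have near_A : nu A - e / 2 <= nu (ultra_trace B1).
  have mW : measurable (W : set (borelRn R n)) by exact: sub_sigma_algebra.
  have mWK : measurable (W `\` K : set (borelRn R n)).
    by apply: measurableD => //; exact: closed_borel.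
  have small S : S `<=` W `\` K -> `|nu S| <= e / 4.
    move=> SWK; rewrite -lee_fin.
    by apply: le_trans (nu_norm_le mWK SWK) _; exact: ltW.
  have nu_split S : K `<=` S -> nu S = nu K + nu (S `\` K).
    move=> KS; rewrite -nuU; first by rewrite setDUK.
    by rewrite setDE setICA setICr setI0.
  have KB1 : K `<=` ultra_trace B1.
    move=> x Kx; have Fx : F x by have [] := KA _ Kx.
    split => //; have UU := U_ultra Fx; apply: filterI; last exact: U_Omega.
    by apply: U_nbhs => //; apply: open_nbhs_nbhs; split => //; exact: KO.
  have B1W : ultra_trace B1 `<=` W.
    move=> x [Fx UB1]; apply: contrapT => nWx.
    have UnO : U x (~` closure D).
      apply: U_nbhs => //; apply: open_nbhs_nbhs; split.
        by apply: closed_openC; exact: closed_closure.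
      by move=> /OW.
    have [y [[Oy _]]] := ultrafilter_meets (U_ultra Fx) UB1 UnO.
    by apply; exact: subset_closure.
  rewrite (nu_split _ KA) (nu_split _ KB1).
  have := small _ (setSD AW); have := small _ (setSD B1W).
  rewrite !ler_norml => /andP[? ?] /andP[? ?]; lra.
have mB1 : borel B1 by exact: measurableI.
have mB2 : borel B2 by exact: measurableD.
have B12 : B1 `&` B2 = set0 by rewrite -subset0 => x [[? _] [_]].
have B12U : B1 `|` B2 = Omega.
  apply/seteqP; split => [x [[]|[]]//|x Ox].
  by have [Kx|nKx] := pselect (D x); [left|right].
have nuF : nu F = nu (ultra_trace B1) + nu (ultra_trace B2).
  by rewrite -ultra_trace_Omega -B12U ultra_trace_setU nuU// ultra_trace_disjoint.
have mu_fin B : measurable B -> (tot_variation mu B < +oo)%E.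
  by move=> _; apply: le_lt_trans (mu_tot_le B) (ltry _).
have muB12 : (`|nu (ultra_trace B1)|%:E + `|nu (ultra_trace B2)|%:E <=
    tot_variation mu Omega)%E.
  rewrite -B12U.
  have tvU := tot_variation_setU_ge (fun B _ => muE B) mu_fin mB1 mB2 B12.
  apply: (le_trans _ tvU).
  by apply: leeD; rewrite -[leLHS]/(`|(nu _)%:E|%E) -muE; exact: le_tot_variation.
apply: (le_trans _ (leeD2r e%:E muB12)).
(* The traces of [B1] and [B2] split [F], so the difference of their [nu]-values is
   [2 * nu (ultra_trace B1) - nu F], which is at least [V - e]. *)
rewrite lee_fin; have := ler_norm (nu (ultra_trace B1)).
have := ler_norm (- nu (ultra_trace B2)); rewrite normrN; lra.
Qed.

End concentrated_charge.

Lemma compact_closure_bounded (R : realType) (n : nat) (A : set 'rV[R]_n) :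
  bounded_set A -> compact (closure A).
Proof.
move=> [M [Mreal MA]]; apply: bounded_closed_compact; last exact: closed_closure.
exists M; split => // M' MM'.
have cl : closed [set x : 'rV[R]_n | `|x| <= M'].
  apply: (@closed_comp _ _ (fun x : 'rV[R]_n => `|x|) [set y | y <= M']).
    by move=> x _; exact: norm_continuous.
  exact: closed_le.
have /closureS : A `<=` [set x : 'rV[R]_n | `|x| <= M'] by exact: MA.
by rewrite -((closure_id _).1 cl).
Qed.

Theorem proposition5p26 (R : realType) (n : nat) (Omega F : set 'rV[R]_n)
    (Omega_borel : borel Omega) (Omega_bounded : bounded_set Omega)
    (F_sub : F `<=` closure Omega) (F_closed : closed F)
    (F_pos : forall x, F x -> forall delta : R, 0 < delta ->
       (0 < lebesgue_Rn (euclidean_ball x delta `&` Omega))%E)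
    (sigma : {charge set (borelRn R n) -> \bar R})
    (sigma_radon : radon_on F sigma) :
  exists mu : {additive_charge set (borelRn R n) -> \bar R},
    [/\ is_ba Omega mu,
        forall phi psi : 'rV[R]_n -> R, Ce_extension Omega phi psi ->
          ba_integral_is (Omega : set (borelRn R n)) mu phi
            (charge_integral sigma F psi),
        core Omega mu `<=` F &
        tot_variation mu Omega = tot_variation sigma F].
Proof.
have U_ex x : exists Ux : set_system 'rV[R]_n, F x ->
    [/\ UltraFilter Ux, nbhs x `<=` Ux, Ux Omega &
      forall B, (lebesgue_Rn B <= 0)%E -> Ux (~` B)].
  (* Off [F], [setT] is a default value that makes [U] a total function. *)
  have [Fx|nFx] := pselect (F x); last by exists setT.
  by have [Ux UxP] := ultrafilter_at_density_point (F_pos x Fx); exists Ux.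
have [U UP] := choice U_ex.
have [nu [nuU nu_sigma nu_le]] := charge_extension sigma.
have U_ultra x : F x -> UltraFilter (U x) by move=> /UP[].
have U_nbhs x : F x -> nbhs x `<=` U x by move=> /UP[].
have U_Omega x : F x -> U x Omega by move=> /UP[].
have U_null x : F x -> forall B, (lebesgue_Rn B <= 0)%E -> U x (~` B).
  by move=> /UP[].
have nu_add : finitely_additive
    (fun B : set (borelRn R n) => nu (ultra_trace F U B)).
  move=> A B _ _ AB; rewrite ultra_trace_setU// nuU//.
  exact: ultra_trace_disjoint.
have [mu muE] := additive_charge_of_finitely_additive nu_add.
exists mu; split.
- exact: (@concentrated_charge_is_ba _ _ Omega F U sigma nu).
- move=> phi psi.
  apply: (@concentrated_charge_integral _ _ Omega F U sigma nu) => //.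
  exact: compact_closure_bounded.
- exact: (@concentrated_charge_core _ _ Omega F U nu).
- exact: (@concentrated_charge_variation _ _ Omega F U sigma nu).
Qed.
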